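(* Let $L_1$ and $L_2$ be nontrivial finite transitive permutation groups, of degrees $d_1$ and $d_2$, and let $\mathfrak{T}$ be the bi-regular tree with valencies $d_1$ and $d_2$. If one of $L_1$ and $L_2$ is not semiprimitive, then for every integer $c$ there exists a group $G$ of automorphisms of $\mathfrak{T}$ such that $(\mathfrak{T},G)$ is locally $[L_1,L_2]$ and $c\le |G_{uv}|<\infty$ for some edge $\{u,v\}$ of $\mathfrak{T}$.
   Context: For a graph $\Gamma$, a vertex $v$ and a group $G$ of automorphisms of $\Gamma$, $\Gamma(v)$ is the neighbourhood of $v$, $G_v$ the stabiliser of $v$, $G_{uv}$ the pointwise stabiliser of $u$ and $v$, and $G_v^{\Gamma(v)}$ the permutation group induced by $G_v$ on $\Gamma(v)$. $\Gamma$ is $G$-locally-transitive if $G_v^{\Gamma(v)}$ is transitive for every vertex $v$. $(\Gamma,G)$ is locally $[L_1,L_2]$ if $\Gamma$ is $G$-locally-transitive and for some edge $\{u,v\}$ there are permutation isomorphisms $G_u^{\Gamma(u)}\cong L_1$ and $G_v^{\Gamma(v)}\cong L_2$. A permutation group is semiregular if only the identity fixes a point, and semiprimitive if each of its normal subgroups is either transitive or semiregular. *)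

(* Defs.v *)
From mathcomp Require Import all_boot all_order all_fingroup ssralg ssrnum ssrint.
From mathcomp Require Import boolp classical_sets functions cardinality.

Set Implicit Arguments.
Unset Strict Implicit.
Unset Printing Implicit Defensive.

Local Open Scope classical_set_scope.
Local Open Scope card_scope.

Section FinitePermutationGroups.
Variable O : finType.
Implicit Types L N : {group {perm O}}.

Definition perm_transitive L : Prop :=
  [transitive L, on [set: O]%SET | 'P].

Definition perm_semiregular L : Prop :=
  forall (x : O) (s : {perm O}), s \in L -> s x = x -> s = 1%g.

Definition perm_semiprimitive L : Prop :=
  forall N, (N <| L)%g -> perm_transitive N \/ perm_semiregular N.

End FinitePermutationGroups.

(* The vertex set may be infinite. *)
Record sgraph := SGraph {
  vertex :> eqType;
  adj : rel vertex;
  adj_sym : symmetric adj;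
  adj_irr : irreflexive adj }.

Section Graphs.
Variable T : sgraph.
Implicit Types (u v : T) (G : set (T -> T)).

Definition graph_connected : Prop :=
  forall u v, exists2 p : seq T, path (@adj T) u p & last u p = v.

(* For an irreflexive symmetric relation, the cycles of length at most 2 in
   the sense of [ucycle] are the empty one and those of the form u, v with
   u, v adjacent; the longer ones are the cycles of the graph. *)
Definition graph_acyclic : Prop :=
  forall c : seq T, ucycle (@adj T) c -> size c <= 2.

Definition is_tree : Prop :=
  [/\ inhabited T, graph_connected & graph_acyclic].

Definition nbhd v : Type := {w : T | adj v w}.

Definition has_valency v (d : nat) : Prop := [set w : T | adj v w] #= `I_d.

Definition is_biregular_tree (d1 d2 : nat) : Prop :=
  is_tree /\
  exists side : T -> bool,
    (forall u v, adj u v -> side u != side v) /\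
    (forall v, has_valency v (if side v then d1 else d2)).

Definition is_automorphism (g : T -> T) : Prop :=
  bijective g /\ (forall u v, adj (g u) (g v) = adj u v).

Record is_automorphism_group G : Prop := {
  autgroup_aut : forall g, G g -> is_automorphism g;
  autgroup_id : G id;
  autgroup_comp : forall g h, G g -> G h -> G (g \o h);
  autgroup_inv : forall g, G g -> exists2 h, G h & cancel g h /\ cancel h g }.

Definition stab G v : set (T -> T) := [set g | G g /\ g v = v].

Definition stab2 G u v : set (T -> T) := [set g | [/\ G g, g u = u & g v = v]].

Definition local_action G v : set (nbhd v -> nbhd v) :=
  [set h | exists2 g, stab G v g & forall w : nbhd v, val (h w) = g (val w)].

Definition locally_transitive G : Prop :=
  forall v (x y : nbhd v), exists2 h, @local_action G v h & h x = y.

End Graphs.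

(* The product of permutations in MathComp is (s * t) x = t (s x), whence the
   reversal in the multiplicativity of [psi]. *)
Definition perm_isomorphic (X : Type) (A : set (X -> X))
    (O : finType) (L : {group {perm O}}) : Prop :=
  exists (phi : X -> O) (psi : (X -> X) -> {perm O}),
    [/\ bijective phi,
        set_bij A [set s | s \in L] psi,
        (forall a b, A a -> A b -> psi (a \o b) = (psi b * psi a)%g)
      & (forall a, A a -> forall x, phi (a x) = psi a (phi x))].

Definition is_locally (T : sgraph) (G : set (T -> T))
    (O1 O2 : finType) (L1 : {group {perm O1}}) (L2 : {group {perm O2}}) : Prop :=
  locally_transitive G /\
  exists u v : T,
    [/\ adj u v,
        perm_isomorphic (@local_action T G u) L1
      & perm_isomorphic (@local_action T G v) L2].

(* Main.v *)
Require Import Defs.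
From mathcomp Require Import all_boot all_order all_fingroup ssralg ssrnum ssrint.
From mathcomp Require Import boolp classical_sets functions cardinality.

(* Suppose L1 has an intransitive normal subgroup N containing some h <> 1 with a
   fixed point x0. Finite groups A and C meeting in B = A :&: C, with A acting on
   A / B as L1 and C acting on C / B as L2, act on the bi-regular tree through
   their free amalgamated product, and the edge stabiliser is B modulo the largest
   subgroup of B normal in both A and C. So it suffices to make B large while
   keeping that subgroup small.

   Take copies of O1 indexed by None and by pairs of an N-orbit d and a point
   (j, n) of O2 * 'I_m. A fixes None, where it acts as L1, and permutes the others
   by its actions on the N-orbits and on O2; C acts in the same way on the pairs
   whose d is not the orbit d0 of x0, while on the remaining copies the action of
   L2 on O2 * 'I_m is conjugated by the shift None -> (y, 0) -> (y, 1) -> ...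
   On every copy except None for A, elements respect base points chosen in the
   N-orbits, and they act on all copies through one coset of N. The two rules agree
   on the stabilisers of x0 and y, and the elements acting as h on the single copy
   (d0, (y, n)) and trivially elsewhere give m elements of B that remain distinct
   modulo the subgroup in question. *)

Set Implicit Arguments.
Unset Strict Implicit.
Unset Printing Implicit Defensive.

Local Open Scope classical_set_scope.
Local Open Scope card_scope.

(** * Walks in acyclic graphs and a criterion for permutation isomorphism *)

Fixpoint nonbacktracking (T : eqType) (s : seq T) : bool :=
  if s is x :: s1 then
    (if s1 is y :: z :: _ then x != z else true) && nonbacktracking s1
  else true.

(** The tail is duplicate-free by induction, so if the head recurs, the segment before its return is
    a [ucycle]. Acyclicity leaves length 1, excluded by irreflexivity, or 2, which is a
    backtracking. *)
Lemma nonbacktracking_uniq (T : sgraph) (s : seq T) :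
  graph_acyclic T -> sorted (@adj T) s -> nonbacktracking s -> uniq s.
Proof.
move=> acT; elim: s => [//|x s IHs] xs /= /andP[xz nbs].
have us : uniq s by apply: IHs => //; exact: path_sorted xs.
rewrite us andbT; apply/negP => xin.
case/splitPr: xin xs xz nbs us => p1 p2 xs xz nbs us.
have cyc : ucycle (@adj T) (x :: p1).
  rewrite /ucycle /=; move: xs => /=; rewrite cat_path /= rcons_path.
  case/and3P=> -> -> _ /=.
  by move: us; rewrite cat_uniq /= negb_or => /and3P[-> /andP[-> _] _].
move/acT: cyc xs xz {us nbs} => /=.
case: p1 => [|y [|z p1]] //= _; first by rewrite adj_irr.
by rewrite eqxx.
Qed.

(** As [f] is onto, at most one permutation matches a given map; this uniqueness makes [psi]
    multiplicative. *)
Lemma perm_isomorphic_of_surj (X : Type) (S : set (X -> X)) (P : finType)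
    (K : {group {perm P}}) (f : X -> P) : bijective f ->
  (forall a b, S a -> S b -> S (a \o b)) ->
  (forall a, S a -> exists2 s, s \in K & forall y, f (a y) = s (f y)) ->
  (forall s, s \in K -> exists2 a, S a & forall y, f (a y) = s (f y)) ->
  perm_isomorphic S K.
Proof.
move=> [f' fK f'K] SM SK KS.
have /choice[psi psiP] : forall a, exists s,
    S a -> s \in K /\ forall y, f (a y) = s (f y).
  move=> a; have [Sa|nSa] := pselect (S a); last by exists 1%g.
  by have [s sK sa] := SK a Sa; exists s.
have psi_uniq a (s : {perm P}) : S a -> (forall y, f (a y) = s (f y)) -> psi a = s.
  move=> Sa as_; apply/permP => o; rewrite -(f'K o) -as_.
  by have [_ ->] := psiP a Sa.
exists f, psi; split; first by exists f'.
- split.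
  + by move=> a Sa; have [] := psiP a Sa.
  + move=> a b; rewrite !inE => Sa Sb ab; apply: funext => y.
    have [_ pa] := psiP a Sa; have [_ pb] := psiP b Sb.
    by apply: (can_inj fK); rewrite pa pb ab.
  + move=> s sK; have [a Sa as_] := KS s sK.
    by exists a => //; exact: psi_uniq.
- move=> a b Sa Sb; apply: psi_uniq => [|y]; first exact: SM.
  have [_ pa] := psiP a Sa; have [_ pb] := psiP b Sb.
  by rewrite permM /= pa pb.
- by move=> a Sa; have [] := psiP a Sa.
Qed.

(** * The action of an amalgam of finite groups on a tree *)

Section AmalgamOnTree.

Variables (W : finGroupType) (O : bool -> finType) (A : bool -> {group W}).
Variables (phi : forall t, W -> {perm O t}) (x : forall t, O t).
Hypothesis phiM : forall t, {in A t &, {morph phi t : a b / (a * b)%g}}.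
Hypothesis stabA : forall t a,
  a \in A t -> (a \in A (~~ t)) = (phi t a (x t) == x t).
Hypothesis transA : forall t (o : O t), exists2 a, a \in A t & phi t a (x t) = o.

Variables (T : sgraph) (side : T -> bool).
Hypothesis side_adj : forall u v : T, adj u v -> side u != side v.
Variables (lab : forall t, T -> T -> O t) (nb : forall t, T -> O t -> T).
Hypothesis adj_nb : forall t u (o : O t), side u = t -> adj u (nb u o).
Hypothesis nbK : forall t u (o : O t), side u = t -> lab t u (nb u o) = o.
Hypothesis labK : forall t u v, side u = t -> adj u v -> nb u (lab t u v) = v.

(* A frame is an edge, written with its endpoint on side [true] first, together
   with an element of the amalgamated subgroup. The frames at a vertex on side
   [t] form a torsor under left multiplication by [A t] through [coord t]. *)
Definition frame : Type := T * T * W.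
Implicit Types (p q : frame) (t : bool) (u v : T).

Definition endpt t p : T := if t then p.1.1 else p.1.2.

Definition orient t u v : T * T := if t then (u, v) else (v, u).

Definition frame_ok p : Prop :=
  [/\ adj p.1.1 p.1.2, side p.1.1 = true, p.2 \in A true & p.2 \in A false].

Lemma frame_orient t u v b : side u = t -> adj u v ->
  b \in A t -> b \in A (~~ t) -> frame_ok (orient t u v, b).
Proof.
case: t => su uv b1 b2; split=> //=; first by rewrite adj_sym.
by have := side_adj uv; rewrite su; case: (side v).
Qed.

Lemma endpt_adj t p : frame_ok p -> adj (endpt t p) (endpt (~~ t) p).
Proof. by case: t => -[] //=; rewrite adj_sym. Qed.

Lemma endpt_side t p : frame_ok p -> side (endpt t p) = t.
Proof.
case=> e s _ _; case: t => //=.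
by have := side_adj e; rewrite s; case: (side _).
Qed.

Lemma frame_base t p : frame_ok p -> p.2 \in A t.
Proof. by case: t => -[]. Qed.

Definition rep t (o : O t) : W :=
  odflt 1%g [pick a in A t | phi t a (x t) == o].

Lemma repP t o : rep o \in A t /\ phi t (rep o) (x t) = o.
Proof.
rewrite /rep; case: pickP => [a /andP[aA /eqP]|no] //=.
by have [a aA ao] := transA o; move: (no a); rewrite /= aA ao eqxx.
Qed.

(** [A t] is a union of right cosets of the amalgamated subgroup. The label of the far endpoint
    selects the coset, and [p.2] the element in it. *)
Definition coord t p : W :=
  (p.2 * rep (lab t (endpt t p) (endpt (~~ t) p)))%g.

Definition of_coord t u (k : W) : frame :=
  (orient t u (nb u (phi t k (x t))), (k * (rep (phi t k (x t)))^-1)%g).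

Lemma phi_base t b k : b \in A t -> b \in A (~~ t) -> k \in A t ->
  phi t (b * k)%g (x t) = phi t k (x t).
Proof.
move=> b1 b2 k1; rewrite phiM // permM.
by move: b2; rewrite stabA // => /eqP ->.
Qed.

Lemma coord_in t p : frame_ok p -> coord t p \in A t.
Proof.
move=> okp; have [rA _] := repP (lab t (endpt t p) (endpt (~~ t) p)).
by rewrite groupM ?(frame_base t okp).
Qed.

Lemma coord_lab t p : frame_ok p ->
  phi t (coord t p) (x t) = lab t (endpt t p) (endpt (~~ t) p).
Proof.
move=> okp; set o := lab _ _ _; have [r1 r2] := repP o.
by rewrite phi_base // ?(frame_base _ okp).
Qed.

Lemma endpt_of_coord t u k : endpt t (of_coord t u k) = u.
Proof. by case: t k. Qed.

Lemma endptN_of_coord t u k :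
  endpt (~~ t) (of_coord t u k) = nb u (phi t k (x t)).
Proof. by case: t k. Qed.

Lemma of_coord_ok t u k : side u = t -> k \in A t -> frame_ok (of_coord t u k).
Proof.
move=> su kA; rewrite /of_coord; move eo: (phi t k (x t)) => o.
have [r1 r2] := repP o.
have kr : (k * (rep o)^-1)%g \in A t by rewrite groupM ?groupV.
apply: frame_orient => //; first exact: adj_nb.
rewrite stabA // phiM ?groupV // permM eo.
have /eqP e1 : phi t 1%g (x t) == x t by rewrite -stabA group1.
by rewrite -[X in _ == X]e1 -(mulgV (rep o)) phiM ?groupV // permM r2.
Qed.

Lemma of_coordK t u k : side u = t -> coord t (of_coord t u k) = k.
Proof.
move=> su; rewrite /coord endpt_of_coord endptN_of_coord nbK //=.
by rewrite mulgKV.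
Qed.

Lemma coordK t p : frame_ok p -> of_coord t (endpt t p) (coord t p) = p.
Proof.
move=> okp; rewrite /of_coord coord_lab // labK ?endpt_side ?endpt_adj //.
rewrite /coord mulgK; case: p {okp} => [[? ?] ?]; by case: t.
Qed.

Definition step t (z : W) p : frame :=
  of_coord t (endpt t p) (z * coord t p).

Lemma step_ok t z p : z \in A t -> frame_ok p -> frame_ok (step t z p).
Proof.
move=> zA okp; apply: of_coord_ok; first exact: endpt_side.
by rewrite groupM //; exact: coord_in.
Qed.

Lemma endpt_step t z p : endpt t (step t z p) = endpt t p.
Proof. exact: endpt_of_coord. Qed.

Lemma coord_step t z p : frame_ok p -> coord t (step t z p) = (z * coord t p)%g.
Proof. by move=> okp; rewrite of_coordK // endpt_side. Qed.

Lemma step1 t p : frame_ok p -> step t 1 p = p.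
Proof. by move=> okp; rewrite /step mul1g coordK. Qed.

Lemma stepM t y z p : frame_ok p ->
  step t y (step t z p) = step t (y * z)%g p.
Proof. by move=> okp; rewrite /step endpt_step coord_step // mulgA. Qed.

(** The result does not depend on [t]: the actions of the two groups on frames agree on the
    amalgamated subgroup. *)
Lemma step_base t b p : frame_ok p -> b \in A true -> b \in A false ->
  step t b p = (p.1, b * p.2)%g.
Proof.
move=> okp b1 b2; have [bt bt'] : b \in A t /\ b \in A (~~ t) by case: (t).
rewrite /step /of_coord phi_base ?coord_in // -mulgA.
by rewrite -[in RHS](coordK t okp).
Qed.

Lemma step_eq t p q : frame_ok p -> frame_ok q -> endpt t p = endpt t q ->
  q = step t (coord t q * (coord t p)^-1) p.
Proof.
by move=> okp okq pq; rewrite /step pq mulgKV coordK.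
Qed.

(** The far endpoint has label [phi t (coord t p) (x t)] before the step and the image of
    [phi t z (x t)] under the same permutation after it. *)
Lemma step_neq t z p : frame_ok p -> z \in A t -> z \notin A (~~ t) ->
  endpt (~~ t) (step t z p) != endpt (~~ t) p.
Proof.
move=> okp zA; apply: contra => /eqP e; rewrite stabA //.
have okz := step_ok zA okp.
have := coord_lab t okz; rewrite coord_step // e endpt_step -coord_lab //.
by rewrite phiM ?coord_in // permM => /perm_inj ->.
Qed.

(** * Words in the two groups and freeness of their action on frames *)

Definition word := seq (bool * W).
Implicit Types w : word.

Definition run w p : frame := foldr (fun l => step l.1 l.2) p w.

Definition valid w : bool := all (fun l => l.2 \in A l.1) w.

Definition reduced w : bool :=
  sorted (fun l l' => l.1 != l'.1) w &&
  all (fun l => (l.2 \in A l.1) && (l.2 \notin A (~~ l.1))) w.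

Lemma reduced_valid w : reduced w -> valid w.
Proof. by case/andP=> _; apply: sub_all => l /andP[]. Qed.

Lemma run_ok w p : valid w -> frame_ok p -> frame_ok (run w p).
Proof.
move=> vw okp; elim: w vw => //= l w IHw /andP[lA /IHw]; exact: step_ok.
Qed.

Lemma run_cat w1 w2 p : run (w1 ++ w2) p = run w1 (run w2 p).
Proof. by rewrite /run foldr_cat. Qed.

Lemma valid_cat w1 w2 : valid (w1 ++ w2) = valid w1 && valid w2.
Proof. exact: all_cat. Qed.

Definition winv w : word := rev [seq (l.1, l.2^-1)%g | l <- w].

Lemma winv_valid w : valid (winv w) = valid w.
Proof.
rewrite /valid all_rev all_map; apply: eq_all => l /=; exact: groupV.
Qed.

Lemma winvK w p : valid w -> frame_ok p -> run (winv w) (run w p) = p.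
Proof.
move=> vw okp; elim: w vw => //= l w IHw /andP[lA vw].
have okr := run_ok vw okp.
rewrite /winv /= rev_cons -cats1 run_cat /= stepM // mulVg step1 //.
exact: IHw.
Qed.

(** Each letter turns the current edge about its endpoint on the side of the letter and, by
    [step_neq], changes the other endpoint. As the sides alternate, the edges met form a walk
    without backtracking from [q] back to [p]. *)
Lemma reduced_walk t z w p : reduced ((t, z) :: w) -> frame_ok p ->
  let q := run ((t, z) :: w) p in
  exists2 s, (exists t', last (endpt true p) s = endpt t' p /\ s <> [::]) &
    sorted (@adj T) [:: endpt (~~ t) q, endpt t q & s] &&
    nonbacktracking [:: endpt (~~ t) q, endpt t q & s].
Proof.
elim: w t z => [|[t' z'] w IHw] t z redw okp q.
  have /and3P[_ /andP[zA zN] _] : reduced [:: (t, z)] := redw.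
  have okq : frame_ok q by apply: step_ok.
  exists [:: endpt (~~ t) p]; first by exists (~~ t).
  have := endpt_adj (~~ t) okq; rewrite negbK {2 4}/q /= => -> /=.
  rewrite !endpt_step endpt_adj //= !andbT; exact: step_neq.
have [tt' redw' zA zN] : [/\ t' = ~~ t, reduced ((t', z') :: w),
    z \in A t & z \notin A (~~ t)].
  case/andP: redw => /= /andP[tt' pw] /andP[/andP[zA zN] al].
  split=> //; last by rewrite /reduced /= pw.
  by move: tt'; case: (t); case: (t').
have := IHw t' z' redw' okp; set q' := run _ p => IH'.
have okq' : frame_ok q' by apply: run_ok => //; exact: reduced_valid.
have okq : frame_ok q by apply: step_ok.
case: IH' => s [t'' [ls s0]]; rewrite tt' negbK => /andP[so nbs].
exists (endpt (~~ t) q' :: s).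
  by exists t''; case: s s0 ls {so nbs}.
have eq : endpt t q = endpt t q' by rewrite /q /= endpt_step.
apply/andP; split.
  rewrite eq; move: so => /= /andP[-> ->]; rewrite !andbT.
  by rewrite -eq -{2}[t]negbK endpt_adj.
rewrite eq; move: nbs => /= -> ; rewrite andbT; exact: step_neq.
Qed.

Hypothesis acT : graph_acyclic T.

(** Otherwise the walk of [reduced_walk] would end at one of its own first two vertices, against
    [nonbacktracking_uniq]. *)
Lemma reduced_run_edge w p : reduced w -> frame_ok p ->
  (run w p).1 = p.1 -> w = [::].
Proof.
case: w => [//|[t z] w] redw okp e.
have [s [t' [ls s0]] /andP[so nbs]] := reduced_walk redw okp.
have /= /and3P[] := nonbacktracking_uniq acT so nbs.
have ee t0 : endpt t0 (run ((t, z) :: w) p) = endpt t0 p.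
  by rewrite /endpt e.
have : endpt t' p \in s.
  by rewrite -ls; case: (s) s0 => //= a l _; exact: mem_last.
rewrite -!/(run ((t, z) :: w) p) !ee inE !negb_or => ins /andP[_ n1] n2.
have : (t' == t) || (t' == ~~ t) by case: (t) (t') => -[].
by case/orP => /eqP tt; rewrite -tt ins in n1 n2.
Qed.

(* The normal form of an amalgamated product, on the level of its action. *)
Lemma run_normal_form w : valid w ->
  exists b s, [/\ b \in A true, b \in A false, reduced s &
    forall p, frame_ok p -> run w p = step true b (run s p)].
Proof.
elim: w => [_|[t z] w IHw].
  exists 1%g, [::]; split; rewrite ?group1 // => p okp; by rewrite step1.
case/andP=> /= zA /IHw[b [s [b1 b2 rs E]]].
have bt t0 : b \in A t0 by case: t0.
have E' p : frame_ok p -> run ((t, z) :: w) p = step t (z * b)%g (run s p).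
  move=> okp; have okr := run_ok (reduced_valid rs) okp.
  by rewrite /= E // !(step_base true) // -(step_base t) // stepM.
have zbA : (z * b)%g \in A t by rewrite groupM.
(* Prefixing [y] to a reduced word: if [y] lies in the amalgamated subgroup it becomes the new [b],
   otherwise it is a new first letter. Below, [y] is [z * b], multiplied by the first letter of [s]
   when that letter comes from the same group. *)
have push y s' : y \in A t -> reduced s' ->
    (if s' is l :: _ then l.1 != t else true) ->
    (forall p, frame_ok p -> run ((t, z) :: w) p = step t y (run s' p)) ->
  exists b s, [/\ b \in A true, b \in A false, reduced s &
    forall p, frame_ok p -> run ((t, z) :: w) p = step true b (run s p)].
  move=> yA rs' hd Ey; have [yB|yN] := boolP (y \in A (~~ t)).
    have [y1 y2] : y \in A true /\ y \in A false.
      by move: yA yB; case: (t).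
    exists y, s'; split=> // p okp.
    by rewrite Ey // !step_base //; apply: run_ok => //; exact: reduced_valid.
  exists 1%g, ((t, y) :: s'); split; rewrite ?group1 //.
    move: rs' hd; rewrite /reduced /= yA yN /=.
    by case: s' {Ey} => [//|l s'] /= /andP[-> ->]; rewrite eq_sym => ->.
  move=> p okp; rewrite step1; first by rewrite Ey.
  by apply: step_ok => //; apply: run_ok => //; exact: reduced_valid.
case: s rs E E' => [|[t' y] s] rs E E'; first exact: push E'.
have [tt'|tt'] := eqVneq t' t; last exact: push E'.
rewrite {t'}tt' in rs E E'.
have /= yA : valid ((t, y) :: s) := reduced_valid rs.
case/andP: yA => /= yA vs.
apply: (push (z * b * y)%g s); first by rewrite groupM.
- move: rs; rewrite /reduced /= => /andP[/path_sorted -> /=].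
  by case/andP.
- by move: rs; rewrite /reduced; case: (s) => [//|l s'] /= /andP[/andP[]]; rewrite eq_sym.
by move=> p okp; rewrite E' //= stepM //; exact: run_ok.
Qed.

(** In the normal form of [w], fixing the edge of [p] forces the reduced part to be empty, and
    fixing its group element then forces [b] to be 1. *)
Lemma run_free w p q : valid w -> frame_ok p -> frame_ok q ->
  run w p = p -> run w q = q.
Proof.
move=> vw okp okq; have [b [s [b1 b2 rs E]]] := run_normal_form vw.
rewrite !E // => e; have okr := run_ok (reduced_valid rs) okp.
have s0 : s = [::].
  apply: (reduced_run_edge rs okp).
  by rewrite -{2}e step_base.
move: e; rewrite s0 /= !step_base //; case: p {okp okr} => e c /= [].
by move/(canRL (mulgK _)); rewrite mulgV => ->; rewrite mul1g; case: (q).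
Qed.

(** Frames at the same vertex differ by some [z] in [A t], so the word [w2] inverse, [z], [w1] fixes
    [p], hence also [q] by [run_free]. This makes the vertex map of [carries_ex] well defined. *)
Lemma run_sync t w1 w2 p q : valid w1 -> valid w2 -> frame_ok p -> frame_ok q ->
  endpt t (run w1 p) = endpt t (run w2 p) ->
  endpt t (run w1 q) = endpt t (run w2 q).
Proof.
move=> v1 v2 okp okq e.
have [ok1 ok2] := (run_ok v1 okp, run_ok v2 okp).
set z := (coord t (run w2 p) * (coord t (run w1 p))^-1)%g.
have zA : z \in A t by rewrite groupM ?groupV //; exact: coord_in.
have v3 : valid (winv w2 ++ (t, z) :: w1).
  by rewrite valid_cat winv_valid v2 /= zA.
have : run (winv w2 ++ (t, z) :: w1) q = q.
  apply: (run_free v3 okp okq).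
  by rewrite run_cat /= -(step_eq ok1 ok2 e) winvK.
rewrite run_cat /= => /(congr1 (run w2)) <-.
have w2K r : frame_ok r -> run w2 (run (winv w2) r) = r.
  move=> okr; have := @winvK (winv w2) r; rewrite winv_valid => /(_ v2 okr).
  rewrite /winv map_rev revK -map_comp.
  suff -> : [seq ((l.1, l.2^-1%g).1, (l.1, l.2^-1%g).2^-1%g) | l <- w2] = w2 by [].
  by rewrite -[RHS]map_id; apply: eq_map => -[a b] /=; rewrite invgK.
rewrite w2K ?endpt_step //; apply: step_ok => //; exact: run_ok.
Qed.

(** * Automorphisms of the tree induced by pairs of frames *)

Hypothesis conT : graph_connected T.
Hypothesis inhT : inhabited T.

Lemma frame_reach_vertex p u : frame_ok p ->
  exists w t, valid w /\ endpt t (run w p) = u.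
Proof.
move=> okp; have [s ps <-] := conT (endpt true p) u.
(* The side of the starting vertex is generalised, since it alternates along the path. *)
elim: s p {1 2}true okp ps => [|v s IHs] p t okp /=; first by exists [::], t.
case/andP=> pv ps; set q : frame := (orient t (endpt t p) v, 1%g).
have okq : frame_ok q by apply: frame_orient; rewrite ?endpt_side ?group1.
have qt : endpt t q = endpt t p by rewrite /q; case: (t).
have qv : endpt (~~ t) q = v by rewrite /q; case: (t).
have [w [t' [vw e]]] := IHs q (~~ t) okq ltac:(by rewrite qv).
exists (w ++ [:: (t, (coord t q * (coord t p)^-1)%g)]), t'; split.
  by rewrite valid_cat vw /= groupM ?groupV //; exact: coord_in.
by rewrite run_cat /= -step_eq // e qv.
Qed.

Lemma frame_trans p q : frame_ok p -> frame_ok q ->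
  exists2 w, valid w & run w p = q.
Proof.
move=> okp okq; have [w [t [vw e]]] := frame_reach_vertex (endpt true q) okp.
have okw := run_ok vw okp.
have tt : t = true by rewrite -(endpt_side t okw) e endpt_side.
rewrite {t}tt in e.
exists ((true, (coord true q * (coord true (run w p))^-1)%g) :: w).
  by rewrite /= vw andbT groupM ?groupV //; exact: coord_in.
by rewrite /= -step_eq.
Qed.

Definition carries (g : T -> T) p q : Prop :=
  forall w t, valid w -> g (endpt t (run w p)) = endpt t (run w q).

Lemma carries_endpt g p q t : carries g p q -> g (endpt t p) = endpt t q.
Proof. by move=> /(_ [::] t); apply. Qed.

Lemma carries_run g p q w : valid w -> carries g p q ->
  carries g (run w p) (run w q).
Proof. by move=> vw gpq w' t vw'; rewrite -!run_cat gpq // valid_cat vw'. Qed.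

Lemma carries_ex p q : frame_ok p -> frame_ok q -> exists g, carries g p q.
Proof.
move=> okp okq.
have /choice[g gP] : forall u, exists u', exists w t,
    [/\ valid w, endpt t (run w p) = u & endpt t (run w q) = u'].
  move=> u; have [w [t [vw e]]] := frame_reach_vertex u okp.
  by exists (endpt t (run w q)), w, t.
exists g => w t vw; have [w' [t' [vw' e <-]]] := gP (endpt t (run w p)).
have tt : t' = t.
  by rewrite -(endpt_side t' (run_ok vw' okp)) e endpt_side //; exact: run_ok.
by rewrite {t'}tt in e *; exact: (run_sync vw' vw okp okq e).
Qed.

Lemma carries_cancel g h p q : frame_ok p ->
  carries g p q -> carries h q p -> cancel g h.
Proof.
move=> okp gpq hqp u; have [w [t [vw <-]]] := frame_reach_vertex u okp.
by rewrite gpq // hqp.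
Qed.

Lemma carries_uniq g h p q : frame_ok p ->
  carries g p q -> carries h p q -> g = h.
Proof.
move=> okp gpq hpq; apply: funext => u.
have [w [t [vw <-]]] := frame_reach_vertex u okp.
by rewrite gpq // hpq.
Qed.

(* A permutation of the frames commuting with both left actions is determined by
   the image of one frame, and by [run_free] any frame can be sent to any other. *)
Definition carrier_group : set (T -> T) :=
  [set g | exists p q, [/\ frame_ok p, frame_ok q & carries g p q]].

Lemma frame_edge u v : adj u v -> exists p t,
  [/\ frame_ok p, endpt t p = u & endpt (~~ t) p = v].
Proof.
move=> uv; exists (orient (side u) u v, 1%g), (side u).
split; first by apply: frame_orient; rewrite ?group1.
  by case: (side u).
by case: (side u).
Qed.

Lemma frame_ex : exists p, frame_ok p.
Proof.
have [u] := inhT; have uv := adj_nb (x (side u)) (erefl (side u)).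
by have [p [t [okp _ _]]] := frame_edge uv; exists p.
Qed.

Lemma carries_adj g p q u v : frame_ok p -> frame_ok q -> carries g p q ->
  adj u v -> adj (g u) (g v).
Proof.
move=> okp okq gpq /frame_edge[r [t [okr <- <-]]].
have [w vw e] := frame_trans okp okr.
by rewrite -e !gpq //; apply: endpt_adj; exact: run_ok.
Qed.

Lemma carrier_group_aut : is_automorphism_group carrier_group.
Proof.
have inv g p q : frame_ok p -> frame_ok q -> carries g p q ->
    exists2 h, carries h q p & cancel g h /\ cancel h g.
  move=> okp okq gpq; have [h hqp] := carries_ex okq okp; exists h => //.
  by split; [exact: (carries_cancel okp gpq hqp) | exact: (carries_cancel okq hqp gpq)].
split.
- move=> g [p [q [okp okq gpq]]]; have [h hqp [gh hg]] := inv _ _ _ okp okq gpq.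
  split; first by exists h.
  move=> u v; apply/idP/idP; last exact: (carries_adj okp okq gpq).
  by move/(carries_adj okq okp hqp); rewrite !gh.
- by have [p okp] := frame_ex; exists p, p.
- move=> g h [p [q [okp okq gpq]]] [p' [q' [okp' okq' hpq]]].
  have [w vw e] := frame_trans okq' okp.
  exists (run w p'), q; split=> //; first exact: run_ok.
  by move=> w' t vw' /=; rewrite -gpq // -e -!run_cat hpq // valid_cat vw'.
- move=> g [p [q [okp okq gpq]]]; have [h hqp [gh hg]] := inv _ _ _ okp okq gpq.
  by exists h => //; exists q, p.
Qed.

(** At the common vertex, [g] sends the frame reached from [p] by [z] to the one reached from [q] by
    [z]: on coordinates this is right multiplication by [k], which acts on labels as [phi t k]. *)
Lemma carries_lab g p q t : frame_ok p -> frame_ok q -> carries g p q ->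
  endpt t p = endpt t q ->
  let k := ((coord t p)^-1 * coord t q)%g in
  k \in A t /\ forall v, adj (endpt t p) v ->
    lab t (endpt t p) (g v) = phi t k (lab t (endpt t p) v).
Proof.
move=> okp okq gpq pq k.
have kA : k \in A t by rewrite groupM ?groupV //; exact: coord_in.
split=> // v pv; set r : frame := (orient t (endpt t p) v, 1%g).
have okr : frame_ok r by apply: frame_orient; rewrite ?endpt_side ?group1.
have rt : endpt t r = endpt t p by rewrite /r; case: (t).
have rv : endpt (~~ t) r = v by rewrite /r; case: (t).
set z := (coord t r * (coord t p)^-1)%g.
have zA : z \in A t by rewrite groupM ?groupV //; exact: coord_in.
have er : r = run [:: (t, z)] p by rewrite /= -step_eq.
have okz : frame_ok (step t z q) by exact: step_ok.
have gv : g v = endpt (~~ t) (step t z q).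
  by rewrite -rv er gpq //= zA.
have zq : endpt t (step t z q) = endpt t p by rewrite endpt_step.
rewrite gv -{1}zq -coord_lab // -rv -rt -coord_lab // coord_step //.
rewrite /z -mulgA -/k phiM ?permM //; exact: coord_in.
Qed.

(** * Local actions of the carrier group *)

Variable L : forall t, {group {perm O t}}.
Hypothesis phi_image : forall t, [set phi t a | a in A t]%SET = L t.

Lemma carrier_locally_transitive : locally_transitive carrier_group.
Proof.
move=> u [v uv] [v' uv']; have [p [t [okp pu pv]]] := frame_edge uv.
have [q [t' [okq qu qv]]] := frame_edge uv'.
have tt : t' = t by rewrite -(endpt_side t' okq) qu -pu endpt_side.
rewrite {t'}tt in qu qv.
have [g gpq] := carries_ex okp okq.
have Gg : carrier_group g by exists p, q.
have gu : g u = u by rewrite -{1}pu (carries_endpt t gpq).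
have gadj (y : nbhd u) : adj u (g (val y)).
  by rewrite -{1}gu; apply: (carries_adj okp okq gpq); exact: valP.
exists (fun y : nbhd u => exist _ (g (val y)) (gadj y)); first by exists g.
by apply: val_inj; rewrite /= -pv (carries_endpt (~~ t) gpq).
Qed.

Lemma carrier_local_action u t : side u = t ->
  perm_isomorphic (@local_action T carrier_group u) (L t).
Proof.
move=> su; have gpaut := carrier_group_aut.
have un (o : O t) : adj u (nb u o) by exact: adj_nb.
apply: (@perm_isomorphic_of_surj _ _ _ _ (fun w : nbhd u => lab t u (val w))).
- exists (fun o : O t => exist _ (nb u o) (un o) : nbhd u) => [[w uw]|o] /=.
    by apply: val_inj; rewrite /= labK.
  by rewrite nbK.
- move=> a b [g [Gg gu] ag] [h [Gh hu] bh]; exists (g \o h).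
    by split; [exact: autgroup_comp | rewrite /= hu].
  by move=> w; rewrite /= ag bh.
- move=> a [g [[p0 [q0 [okp0 okq0 gpq0]]] gu] ag].
  have [p [t' [okp pu _]]] := frame_edge (un (x t)).
  have tt : t' = t by rewrite -(endpt_side t' okp) pu su.
  rewrite {t'}tt in pu.
  (* The pair of frames defining [g] is moved to the vertex [u], so that [carries_lab] applies
     there. *)
  have [w vw e] := frame_trans okp0 okp.
  have gpq := carries_run vw gpq0; rewrite e in gpq.
  have okq := run_ok vw okq0.
  have := carries_lab okp okq gpq (t := t).
  rewrite -(carries_endpt t gpq) pu gu => /(_ erefl)[kA kl].
  eexists; first by rewrite -phi_image; apply: imset_f kA.
  by move=> y; rewrite ag kl //; exact: valP.
- move=> s; rewrite -phi_image => /imsetP[k kA ->].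
  have okp := of_coord_ok su (group1 (A t)); have okq := of_coord_ok su kA.
  have [g gpq] := carries_ex okp okq.
  have gu : g u = u.
    by rewrite -{1}(endpt_of_coord t u 1%g) (carries_endpt t gpq) endpt_of_coord.
  have gadj (y : nbhd u) : adj u (g (val y)).
    by rewrite -{1}gu; apply: (carries_adj okp okq gpq); exact: valP.
  exists (fun y : nbhd u => exist _ (g (val y)) (gadj y)).
    by exists g => //; split=> //; do 2!eexists; split; [exact: okp | exact: okq |].
  move=> [v uv] /=; have := carries_lab okp okq gpq (t := t).
  rewrite !endpt_of_coord !of_coordK // invg1 mul1g => /(_ erefl)[_]; exact.
Qed.

(** * The kernel of the action and the size of an edge stabiliser *)

(** For every frame [q], carrying [q] to its image under [b] is the identity on the tree. *)
Definition core_pred (b : W) : Prop :=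
  [/\ b \in A true, b \in A false &
    forall q w t, frame_ok q -> valid w ->
      endpt t (run w (step true b q)) = endpt t (run w q)].

Definition core_set : {set W} := [set b | `[< core_pred b >]]%SET.

Lemma core_setP b : reflect (core_pred b) (b \in core_set).
Proof. by rewrite inE; exact: asboolP. Qed.

Lemma core_group_set : group_set core_set.
Proof.
apply/group_setP; split.
  apply/core_setP; split=> [||q w t okq vw]; rewrite ?group1 //.
  by rewrite step1.
move=> a b; case/core_setP=> a1 a2 ca /core_setP[b1 b2 cb].
apply/core_setP; split; rewrite ?groupM // => q w t okq vw.
by rewrite -stepM // ca ?cb //; exact: step_ok.
Qed.

Canonical core_group := Group core_group_set.

Lemma core_norm t : A t \subset 'N(core_group)%g.
Proof.
apply/fintype.subsetP => z zA; rewrite inE; apply/fintype.subsetP => c /imsetP[b].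
case/core_setP=> b1 b2 cb ->{c}.
have [bt bt'] : b \in A t /\ b \in A (~~ t) by case: (t).
have bzA : (b ^ z)%g \in A t by rewrite groupJ.
(* Acting by [b ^ z] and then by [w] is the same as acting by [z], then [b], then [w] extended by
   the inverse of [z]; the core property of [b] at the frame moved by [z] removes [b]. *)
have E q : frame_ok q -> forall w t0, valid w ->
    endpt t0 (run w (step t (b ^ z)%g q)) = endpt t0 (run w q).
  move=> okq w t0 vw; have okz := step_ok zA okq.
  rewrite conjgE mulgA -stepM // -stepM // (step_base t okz) // -(step_base true okz) //.
  have vz : valid (w ++ [:: (t, z^-1)%g]) by rewrite valid_cat vw /= groupV zA.
  have := cb _ _ t0 okz vz; rewrite !run_cat /= => ->.
  by rewrite stepM // mulVg step1.
have bzN : (b ^ z)%g \in A (~~ t).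
  have [p okp] := frame_ex.
  apply: contraT => /(step_neq okp bzA); have := E p okp [::] (~~ t) isT.
  by move=> /= ->; rewrite eqxx.
have [bz1 bz2] : (b ^ z)%g \in A true /\ (b ^ z)%g \in A false.
  by move: bzA bzN; case: (t).
apply/core_setP; split=> // q w t0 okq vw.
by rewrite (step_base true) // -(step_base t) // E.
Qed.

(** Sending [a] to the automorphism carrying [p] to its image under [a] maps the amalgamated
    subgroup onto the edge stabiliser. Two elements with the same image differ by an element of
    [core_group], which both groups normalise. *)
Lemma carrier_stab2 (m : nat) (b : 'I_m -> W) :
  (forall i, b i \in A true :&: A false) ->
  (forall K : {group W}, K \subset A true :&: A false ->
     (forall t, A t \subset 'N(K)%g) ->
     forall i j, (b i * (b j)^-1)%g \in K -> i = j) ->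
  exists u v : T, adj u v /\ exists n : nat,
    stab2 carrier_group u v #= `I_n /\ m <= n.
Proof.
move=> bB bK.
have [p okp] := frame_ex.
exists (endpt true p), (endpt false p); split; first exact: (endpt_adj true okp).
set S := stab2 _ _ _.
have /choice[f fP] : forall a : W, exists g, a \in A true :&: A false ->
    carries g p (step true a p).
  move=> a; have [|] := boolP (a \in A true :&: A false); last by exists id.
  rewrite inE => /andP[a1 a2].
  by have [g gP] := carries_ex okp (step_ok a1 okp); exists g.
have fS : f @` [set` A true :&: A false] = S.
  apply/seteqP; split=> [_ [a /= aB <-]|g [[p0 [q0 [okp0 okq0 gpq0]]] g1 g2]].
    have := fP a aB; move: aB; rewrite inE => /andP[a1 a2] fa.
    have okq := step_ok a1 okp.
    split; first by exists p, (step true a p).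
      by rewrite (carries_endpt true fa) endpt_step.
    rewrite (carries_endpt false fa) (step_base true okp) // -(step_base false okp) //.
  have [w vw e] := frame_trans okp0 okp.
  have := carries_run vw gpq0; rewrite e; set q := run w q0 => gpq.
  have okq : frame_ok q by exact: run_ok.
  have q1 : endpt true p = endpt true q by rewrite -(carries_endpt true gpq).
  have q2 : endpt false p = endpt false q by rewrite -(carries_endpt false gpq).
  have [p1 p2] := (frame_base true okp, frame_base false okp).
  have [q3 q4] := (frame_base true okq, frame_base false okq).
  have aB : (q.2 * p.2^-1)%g \in A true :&: A false.
    by rewrite inE !groupM ?groupV.
  exists (q.2 * p.2^-1)%g => //; apply: (carries_uniq okp (fP _ aB)).
  move: (aB); rewrite inE => /andP[a1 a2].
  rewrite step_base // mulgKV; suff -> : p.1 = q.1 by case: (q) gpq.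
  by move: q1 q2; rewrite /endpt; case: (p.1) (q.1) => [? ?] [? ?] /= -> ->.
have [n Sn] : finite_set S by rewrite -fS; apply: finite_image; exact: finite_finpred.
exists n; split=> //; rewrite -card_le_II -(card_le_eqr Sn).
pose h k := if insub k is Some i then f (b i) else id.
have hE (i : 'I_m) : h i = f (b i) by rewrite /h valK.
have hinj : {in `I_m &, injective h}.
  move=> i j; rewrite !inE /= => im jm.
  rewrite -[i]/(val (Ordinal im)) -[j]/(val (Ordinal jm)) !hE => hij.
  move: (Ordinal im) (Ordinal jm) hij => {im jm} {}i {}j fij; congr val.
  apply: (bK core_group _ core_norm).
    by apply/fintype.subsetP => a /core_setP[a1 a2 _]; rewrite inE a1.
  have := bB i; rewrite inE => /andP[i1 i2].
  have := bB j; rewrite inE => /andP[j1 j2].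
  apply/core_setP; split; rewrite ?groupM ?groupV // => q w t okq vw.
  have okj : frame_ok (step true (b j)^-1 q) by apply: step_ok; rewrite ?groupV.
  rewrite -stepM //.
  have v1 i' : valid (w ++ [:: (true, b i')]).
    by have := bB i'; rewrite valid_cat vw inE /= => /andP[->].
  have e : endpt t (run (w ++ [:: (true, b i)]) p) =
           endpt t (run (w ++ [:: (true, b j)]) p).
    by rewrite !run_cat /= -!(fP _ (bB _)) // fij.
  have := run_sync (v1 i) (v1 j) okp okj e; rewrite !run_cat /= => ->.
  by rewrite stepM // mulgV step1.
rewrite -(card_le_eql (inj_card_eq hinj)); apply: subset_card_le.
move=> _ [k km <-]; rewrite -fS; exists (b (Ordinal km)); first exact: bB.
by rewrite -hE.
Qed.

End AmalgamOnTree.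

(** * The finite amalgam attached to an intransitive normal subgroup *)

Section FiniteAmalgam.

Variables (O1 O2 : finType) (L1 N : {group {perm O1}}) (L2 : {group {perm O2}}).
Variables (x0 z : O1) (h : {perm O1}) (y : O2) (r1 : {perm O2}) (m : nat).
Hypothesis L1_trans : perm_transitive L1.
Hypothesis N_normal : (N <| L1)%g.
Hypothesis hN : h \in N.
Hypothesis h_neq1 : h != 1%g.
Hypothesis h_x0 : h x0 = x0.
Hypothesis z_orbit : forall n, n \in N -> n x0 != z.
Hypothesis r1L : r1 \in L2.
Hypothesis r1y : r1 y != y.

(** * Orbits of the normal subgroup and their base points *)

Definition orb (o : O1) : {set O1} := orbit 'P N o.

Lemma orb_refl o : o \in orb o. Proof. exact: orbit_refl. Qed.

Lemma orb_act n o : n \in N -> orb (n o) = orb o.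
Proof. by move=> nN; apply/orbit_eqP; exact: mem_orbit. Qed.

(** The choice depends only on the set [orb o], so it is constant on orbits; the first branch makes
    [x0] the base point of its own orbit. *)
Definition section_pt (o : O1) : O1 :=
  if x0 \in orb o then x0 else odflt o [pick o' in orb o].

Lemma section_pt_orbit o : section_pt o \in orb o.
Proof.
rewrite /section_pt; case: ifP => [//|_].
by case: pickP => [//|/(_ o)]; rewrite /= orb_refl.
Qed.

Lemma section_pt_eq n o : n \in N -> section_pt (n o) = section_pt o.
Proof.
move=> nN; rewrite /section_pt orb_act //; case: ifP => // _.
by case: pickP => [//|/(_ o)]; rewrite /= orb_refl.
Qed.

Lemma section_pt_ex o : exists2 n, n \in N & n o = section_pt o.
Proof. by have /orbitP[n nN <-] := section_pt_orbit o; exists n. Qed.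

Lemma section_pt_id o : section_pt (section_pt o) = section_pt o.
Proof. by have [n nN e] := section_pt_ex o; rewrite -{1}e section_pt_eq. Qed.

Lemma section_pt_x0 : section_pt x0 = x0.
Proof. by rewrite /section_pt orb_refl. Qed.

Lemma conj_N s n : s \in L1 -> n \in N -> exists2 n', n' \in N & (n * s = s * n')%g.
Proof.
move=> sL nN; exists (n ^ s)%g; last by rewrite -conjgC.
by rewrite memJ_norm //; apply: fintype.subsetP sL; exact: normal_norm N_normal.
Qed.

Lemma section_pt_act s o : s \in L1 -> section_pt (s (section_pt o)) = section_pt (s o).
Proof.
move=> sL; have [n nN <-] := section_pt_ex o; have [n' n'N e] := conj_N sL nN.
by rewrite -permM e permM section_pt_eq.
Qed.

(* Stands for the set of [N]-orbits, each represented by a point of it. *)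
Local Notation orbit_rep := {o : O1 | section_pt o == o}.

Definition orep (o : O1) : orbit_rep :=
  exist _ (section_pt o) (introT eqP (section_pt_id o)).

Definition d0 := orep x0.

Definition oact (s : {perm O1}) (d : orbit_rep) : orbit_rep := orep (s (val d)).

Lemma val_d0 : val d0 = x0. Proof. exact: section_pt_x0. Qed.

Lemma orep_val d : orep (val d) = d.
Proof. by apply: val_inj => /=; apply/eqP; exact: (valP d). Qed.

Lemma oact1 d : oact 1 d = d.
Proof. by rewrite /oact perm1 orep_val. Qed.

Lemma oactM s s' d : s' \in L1 -> oact (s * s') d = oact s' (oact s d).
Proof. by move=> s'L; apply: val_inj; rewrite /= section_pt_act // permM. Qed.

Lemma oact_coset s s' d : s \in L1 -> s' \in (N :* s)%g -> oact s' d = oact s d.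
Proof.
move=> sL /rcosetP[n nN ->]; have [n' n'N e] := conj_N sL nN.
by apply: val_inj; rewrite /= e permM section_pt_eq.
Qed.

Lemma oact_d0 (s : {perm O1}) : s x0 = x0 -> oact s d0 = d0.
Proof. by move=> sx; rewrite /oact val_d0 sx. Qed.

Lemma oact_eq_d0 (s : {perm O1}) d :
  s \in L1 -> s x0 = x0 -> (oact s d == d0) = (d == d0).
Proof.
move=> sL sx; apply/eqP/eqP => [e|->]; last exact: oact_d0.
rewrite -[d]oact1 -(mulgV s) oactM ?groupV // e oact_d0 //.
by rewrite -{1}sx permK.
Qed.

(** * The shifted action on the chain of indices *)

Local Notation index := (O2 * 'I_m)%type.

Definition level (r : {perm O2}) (i : index) : index := (r i.1, i.2).

Definition level_fun (r : {perm O2}) (j : option index) : option index :=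
  omap (level r) j.

Lemma level_fun_inj r : injective (level_fun r).
Proof. by move=> [[a n]|] [[a' n']|] //= [/perm_inj -> ->]. Qed.

Definition level_perm r : {perm option index} := perm (@level_fun_inj r).

(* The cycle None -> (y, 0) -> (y, 1) -> ... -> (y, m - 1) -> None. *)
Definition shift_fun (j : option index) : option index :=
  match j with
  | None => omap (pair y) (insub 0)
  | Some i => if i.1 == y then omap (pair y) (insub i.2.+1) else Some i
  end.

Lemma shift_fun_inj : injective shift_fun.
Proof.
have ins k : k < m -> exists i : 'I_m, insub k = Some i /\ val i = k.
  by move=> km; exists (Ordinal km); rewrite insubT.
have zero (n : 'I_m) : exists i : 'I_m, insub 0 = Some i /\ val i = 0.
  by apply: ins; apply: leq_ltn_trans (ltn_ord n).
have nz (n : 'I_m) : omap (pair y) (insub 0) <> omap (pair y) (insub n.+1 : option 'I_m).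
  have [i [-> i0]] := zero n; case: insubP => [k _ kn|//] /= [ik].
  by move: kn; rewrite -ik i0.
have ny (k : nat) a (n : 'I_m) : a != y -> omap (pair y) (insub k) <> Some (a, n).
  by move=> ay; case: insubP => //= k' _ _ [ya]; rewrite ya eqxx in ay.
move=> [[a n]|] [[a' n']|] //=.
- have [->|ay] := eqVneq a y; have [->|a'y] := eqVneq a' y => //.
  + case: insubP => [k _ kn|nm]; case: insubP => [k' _ kn'|nm'] //=.
      case=> kk'; congr (Some (_, _)); apply: val_inj; apply: succn_inj.
      by rewrite -kn -kn' kk'.
    (* Both successors are out of range, so [n] and [n'] both equal [m - 1]. *)
    move=> _; congr (Some (_, _)); apply: val_inj => /=.
    have := ltn_ord n; have := ltn_ord n'; rewrite -!leqNgt in nm nm'.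
    move=> n'm nm_; apply: succn_inj; apply/eqP.
    by rewrite eqn_leq (leq_trans nm_ nm') (leq_trans n'm nm).
  + by move/ny => /(_ a'y).
  + by move/esym/ny => /(_ ay).
- by case: (eqVneq a y) => [_ /esym/nz|ay /esym/(ny _ _ _ ay)].
- by case: (eqVneq a' y) => [_ /nz|ay /(ny _ _ _ ay)].
Qed.

Definition shift : {perm option index} := perm shift_fun_inj.

(* Conjugating by [shift] preserves the action of the stabiliser of [y], since
   [shift] only moves points fixed by that stabiliser. *)
Definition twist r : {perm option index} := (shift * level_perm r * shift^-1)%g.

Lemma level_permM r r' : level_perm (r * r') = (level_perm r * level_perm r')%g.
Proof.
by apply/permP => -[i|]; rewrite permM !permE //= /level /= permM.
Qed.

Lemma level_perm1 : level_perm 1 = 1%g.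
Proof. by apply/permP => -[[a n]|]; rewrite !permE //= /level perm1. Qed.

Lemma twistM r r' : twist (r * r') = (twist r * twist r')%g.
Proof. by rewrite /twist level_permM !mulgA mulgKV. Qed.

Lemma twist1 : twist 1 = 1%g.
Proof. by rewrite /twist level_perm1 mulg1 mulgV. Qed.

Lemma twist_fix (r : {perm O2}) : r y = y -> twist r = level_perm r.
Proof.
move=> ry; rewrite /twist; apply/(canLR (mulgK _))/permP => -[[a n]|].
  have ay : (r a == y) = (a == y) by rewrite -{1}ry (inj_eq perm_inj).
  rewrite !permM !permE /= ay; case: eqP => //= _.
  by case: insub => //= k; rewrite /level /= ry.
by rewrite !permM !permE /=; case: insub => //= k; rewrite /level /= ry.
Qed.

(** * The two actions on the indices of the copies *)

Local Notation block := (option (orbit_rep * index)).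

Definition embed (j : option index) : block := omap (pair d0) j.

Definition basept (b : block) : O1 := if b is Some (d, _) then val d else x0.

Definition block_actA (s : {perm O1}) (r : {perm O2}) (b : block) : block :=
  if b is Some (d, i) then Some (oact s d, level r i) else None.

Definition block_actC (s : {perm O1}) (r : {perm O2}) (b : block) : block :=
  if b is Some (d, i) then
    if d == d0 then embed (twist r (Some i)) else Some (oact s d, level r i)
  else embed (twist r None).

Lemma basept_embed j : basept (embed j) = x0.
Proof. by case: j => //= i; exact: val_d0. Qed.

Lemma levelM r r' i : level (r * r') i = level r' (level r i).
Proof. by rewrite /level permM. Qed.

Lemma level1 i : level 1 i = i.
Proof. by case: i => a n; rewrite /level perm1. Qed.

Lemma block_actA1 b : block_actA 1 1 b = b.
Proof. by case: b => [[d i]|] //=; rewrite oact1 level1. Qed.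

Lemma block_actAM s s' r r' b : s' \in L1 ->
  block_actA (s * s') (r * r') b = block_actA s' r' (block_actA s r b).
Proof. by move=> s'L; case: b => [[d i]|] //=; rewrite oactM // levelM. Qed.

Lemma block_actC1 b : block_actC 1 1 b = b.
Proof.
case: b => [[d i]|] /=; last by rewrite twist1 perm1.
by case: eqP => [->|_]; rewrite ?twist1 ?perm1 // oact1 level1.
Qed.

Lemma block_actC_embed s r j : block_actC s r (embed j) = embed (twist r j).
Proof. by case: j => //= i; rewrite eqxx. Qed.

Lemma block_actCM (s s' : {perm O1}) r r' b : s \in L1 -> s' \in L1 -> s x0 = x0 ->
  block_actC (s * s') (r * r') b = block_actC s' r' (block_actC s r b).
Proof.
move=> sL s'L sx; case: b => [[d i]|] /=.
  case: ifP => dd; first by rewrite block_actC_embed twistM permM.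
  by rewrite /= oact_eq_d0 // dd oactM // levelM.
by rewrite block_actC_embed twistM permM.
Qed.

(** Since [r] fixes [y], the twist disappears; since [s'] fixes [x0], the orbit [d0] is preserved;
    and orbits only see the coset of [s]. *)
Lemma block_actC_actA (s s' : {perm O1}) (r : {perm O2}) b :
  s \in L1 -> s' \in (N :* s)%g -> s' x0 = x0 -> r y = y ->
  block_actC s' r b = block_actA s r b.
Proof.
move=> sL s'N s'x ry; rewrite /block_actC twist_fix //.
case: b => [[d i]|]; last by rewrite permE.
rewrite permE /= (oact_coset d sL s'N); case: eqP => [->|//].
by rewrite -(oact_coset d0 sL s'N) oact_d0.
Qed.

(** * The two finite groups and their permutation actions *)

Local Notation point := (block * O1)%type.

(* [a] permutes the copies [{b} * O1] of [O1] as [f], each through an element of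
   the coset [N s] that matches base points; the flag [e] waives the matching
   on the copy indexed by [None]. *)
Definition acts_by (e : bool) (f : block -> block) (s : {perm O1})
    (a : {perm point}) : Prop :=
  exists p : block -> {perm O1}, forall b,
    [/\ p b \in (N :* s)%g,
        e && (b == None) || (p b (basept b) == basept (f b)) &
        forall o, a (b, o) = (f b, p b o)].

Lemma acts_byM (e : bool) f f' s s' a a' : s \in L1 -> 
  (e -> forall b, (f b == None) = (b == None)) ->
  acts_by e f s a -> acts_by e f' s' a' ->
  acts_by e (f' \o f) (s * s')%g (a * a')%g.
Proof.
move=> sL fN [p pP] [p' p'P]; exists (fun b => p b * p' (f b))%g => b.
have [p1 p2 p3] := pP b; have [q1 q2 q3] := p'P (f b); split.
- case/rcosetP: p1 => n nN ->; case/rcosetP: q1 => n' n'N ->.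
  have [k kN e'] := conj_N (groupVr sL) n'N.
  apply/rcosetP; exists (n * k^-1^-1)%g; first by rewrite invgK groupM.
  rewrite invgK -!mulgA; congr (_ * _)%g; rewrite !mulgA; congr (_ * _)%g.
  have := congr1 (fun u => s * u * s)%g e'; by rewrite !mulgA mulgV mul1g mulgKV.
- case ee: e p2 q2 => /=; last by move=> /eqP p2 /eqP q2; rewrite permM p2 q2.
  rewrite fN //; case: eqP => //= _ /eqP p2 /eqP q2.
  by rewrite permM p2 q2.
- by move=> o; rewrite permM p3 q3 permM.
Qed.

Local Notation W := ({perm point} * {perm O2})%type.

(** Keeping [r] as the component [w.2] gives the second group its map onto [L2]; the map of the
    first onto [L1] is read on the copy [None]. *)
Definition inA (w : W) : Prop :=
  [/\ w.2 \in L2, w.2 y = y &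
    exists2 s, s \in L1 & acts_by true (block_actA s w.2) s w.1].

Definition inC (w : W) : Prop :=
  w.2 \in L2 /\ exists s : {perm O1},
    [/\ s \in L1, s x0 = x0 & acts_by false (block_actC s w.2) s w.1].

Definition setA : {set W} := [set w | `[< inA w >]]%SET.
Definition setC : {set W} := [set w | `[< inC w >]]%SET.

Lemma setAP w : reflect (inA w) (w \in setA).
Proof. by rewrite inE; exact: asboolP. Qed.

Lemma setCP w : reflect (inC w) (w \in setC).
Proof. by rewrite inE; exact: asboolP. Qed.

Lemma acts_by1 e f : f =1 id -> acts_by e f 1 1.
Proof.
move=> fid; exists (fun=> 1%g) => b; split; first by rewrite rcoset1 group1.
  by rewrite fid perm1 eqxx orbT.
by move=> o; rewrite !perm1 fid.
Qed.

Lemma acts_by_eq e f f' s a : f =1 f' -> acts_by e f s a -> acts_by e f' s a.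
Proof. by move/funext => ->. Qed.

Lemma setA_group : group_set setA.
Proof.
apply/group_setP; split.
  apply/setAP; split; rewrite ?group1 ?perm1 //; exists 1%g => //.
  by apply: acts_by1; exact: block_actA1.
move=> w w' /setAP[r1_ ry [s sL ss]] /setAP[r1' r'y [s' s'L ss']].
apply/setAP; split; first by rewrite groupM.
  by rewrite /= permM ry.
exists (s * s')%g; first by rewrite groupM.
apply: acts_by_eq (acts_byM sL _ ss ss').
  by move=> b; rewrite /= block_actAM.
by move=> _ [[d i]|].
Qed.

Lemma setC_group : group_set setC.
Proof.
apply/group_setP; split.
  apply/setCP; split; rewrite ?group1 //; exists 1%g; split; rewrite ?group1 ?perm1 //.
  by apply: acts_by1; exact: block_actC1.
move=> w w' /setCP[r1_ [s [sL sx ss]]] /setCP[r1' [s' [s'L s'x ss']]].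
apply/setCP; split; first by rewrite groupM.
exists (s * s')%g; split; rewrite ?groupM ?permM ?sx //.
apply: acts_by_eq (acts_byM sL _ ss ss') => //.
by move=> b; rewrite /= block_actCM.
Qed.

Canonical groupA := Group setA_group.
Canonical groupC := Group setC_group.

Definition root_perm (w : W) : {perm O1} :=
  odflt 1%g [pick s : {perm O1} | [forall o, w.1 (None, o) == (None, s o)]].

Lemma root_permE (w : W) (s : {perm O1}) :
  (forall o, w.1 (None, o) = (None, s o)) -> root_perm w = s.
Proof.
move=> ws; rewrite /root_perm; case: pickP => [s' /forallP s'P|/(_ s)] /=.
  by apply/permP => o; have /eqP := s'P o; rewrite ws => -[].
by move/negbT/forallPn => [o]; rewrite ws eqxx.
Qed.

Lemma N_sub_L1 : {subset N <= L1}.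
Proof. by apply/fintype.subsetP; exact: normal_sub N_normal. Qed.

Lemma setA_root w : w \in setA -> root_perm w \in L1 /\
  (forall o, w.1 (None, o) = (None, root_perm w o)).
Proof.
case/setAP=> _ _ [s sL [p pP]]; have [pN _ pw] := pP None.
rewrite (root_permE pw); split=> //.
by case/rcosetP: pN => n /N_sub_L1 nL ->; rewrite groupM.
Qed.

Lemma root_permM : {in setA &, {morph root_perm : a b / (a * b)%g}}.
Proof.
move=> a b /setA_root[_ aP] /setA_root[_ bP]; apply: root_permE => o.
by rewrite (_ : (a * b)%g.1 = (a.1 * b.1)%g) // [in LHS]permM aP bP permM.
Qed.

(** In the second group the copy [None] must match base points, which forces [x0] to be fixed.
    Conversely [root_perm w] lies in the coset of [s] and can replace it. *)
Lemma setA_stab w : w \in setA -> (w \in setC) = (root_perm w x0 == x0).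
Proof.
move=> wA; have [rL rw] := setA_root wA; apply/setCP/eqP.
  case=> _ [s [sL sx [p pP]]]; have [_ /=] := pP None; rewrite twist_fix.
    rewrite permE /= => /eqP px pw; have := pw x0.
    by rewrite rw px => -[].
  by case/setAP: wA.
move=> rx; case/setAP: wA => wL wy [s sL [p pP]].
have pE : p None = root_perm w.
  by have [_ _ pw] := pP None; rewrite (root_permE pw).
have [rs _ _] := pP None; rewrite pE in rs.
split=> //; exists (root_perm w); split=> //; exists p => b.
have [p1 p2 p3] := pP b; rewrite (block_actC_actA b sL rs rx wy); split=> //.
  by rewrite (rcoset_eqP rs).
case: b p2 {p1 p3} => [//|_] /=; by rewrite pE rx.
Qed.

Lemma setC_stab w : w \in setC -> (w \in setA) = (w.2 y == y).
Proof.
move=> wC; apply/setAP/eqP; first by case.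
move=> wy; case/setCP: wC => wL [s [sL sx [p pP]]]; split=> //.
exists s => //; exists p => b; have [p1 /= p2 p3] := pP b.
have e := block_actC_actA b sL (rcoset_refl _ _) sx wy.
by rewrite -e p2 orbT.
Qed.

Lemma acts_by_ex f (p : block -> {perm O1}) : injective f ->
  exists a : {perm point}, forall b o, a (b, o) = (f b, p b o).
Proof.
move=> finj; pose g (u : point) : point := (f u.1, p u.1 u.2).
have ginj : injective g.
  by move=> [b o] [b' o'] [/finj <- /perm_inj <-].
by exists (perm ginj) => b o; rewrite permE.
Qed.

(** On [None] use [s] itself; on every other copy, follow [s] by an element of [N] that moves the
    image of the base point back to a base point. *)
Lemma setA_lift s : s \in L1 -> exists w, [/\ w \in setA, root_perm w = s &
  forall d i, exists p : {perm O1}, forall o,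
    w.1 (Some (d, i), o) = (Some (oact s d, i), p o)].
Proof.
move=> sL.
have /choice[p pP] : forall b : block, exists n,
    n \in N /\ n (s (basept b)) = section_pt (s (basept b)).
  by move=> b; have [n nN e] := section_pt_ex (s (basept b)); exists n.
pose q (b : block) := if b is Some _ then (s * p b)%g else s.
have finj : injective (block_actA s 1).
  apply: (can_inj (g := block_actA s^-1 1)) => b.
  by rewrite -block_actAM ?groupV // mulgV mulg1 block_actA1.
have [a aP] := acts_by_ex q finj; exists (a, 1%g); split.
- apply/setAP; split; rewrite ?group1 ?perm1 //; exists s => //.
  exists q => b; split=> //.
    case: b => [b|]; last exact: rcoset_refl.
    have [pN _] := pP (Some b); apply/rcosetP.
    have [n nN e] := conj_N (groupVr sL) (groupVr pN).
    exists n^-1%g; rewrite ?groupV //; rewrite /q.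
    by apply: invg_inj; rewrite !invMg invgK e.
  case: b => [[d i]|] //=.
  by have [_ e] := pP (Some (d, i)); rewrite permM e.
- by apply: root_permE => o; rewrite aP.
- by move=> d i; exists (q (Some (d, i))) => o; rewrite aP /= level1.
Qed.

Lemma setC_lift r : r \in L2 -> exists w, [/\ w \in setC, w.2 = r &
  forall b o, (w.1 (b, o)) = (block_actC 1 r b, o)].
Proof.
move=> rL.
have finj : injective (block_actC 1 r).
  apply: (can_inj (g := block_actC 1 r^-1)) => b.
  by rewrite -block_actCM ?group1 ?perm1 // mulgV mulg1 block_actC1.
have [a aP] := acts_by_ex (fun=> 1%g) finj; exists (a, r); split=> //.
  apply/setCP; split=> //; exists 1%g; split; rewrite ?group1 ?perm1 //.
  exists (fun=> 1%g) => b; split=> //; first by rewrite rcoset1 group1.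
  rewrite perm1 /= ; case: b => [[d i]|]; last by rewrite /= basept_embed.
  rewrite /=; case: (d =P d0) => [->|_]; first by rewrite basept_embed val_d0.
  by apply/eqP; rewrite -{1}(oact1 d).
by move=> b o; rewrite aP perm1.
Qed.

Lemma root_perm_image : [set root_perm a | a in setA]%SET = L1.
Proof.
apply/setP => s; apply/imsetP/idP => [[w /setA_root[wL _] ->] //|sL].
by have [w [wA e _]] := setA_lift sL; exists w.
Qed.

Lemma snd_image : [set a.2 | a in setC]%SET = L2.
Proof.
apply/setP => r; apply/imsetP/idP => [[w /setCP[wL _] ->] //|rL].
by have [w [wC e _]] := setC_lift rL; exists w.
Qed.

(** * Many elements of the intersection, independent modulo the core *)

Definition fibre_fun (n : 'I_m) (u : point) : point :=
  (u.1, if u.1 == Some (d0, (y, n)) then h u.2 else u.2).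

Lemma fibre_fun_inj n : injective (fibre_fun n).
Proof. by move=> [b o] [b' o'] [<-] /=; case: eqP => _ => [/perm_inj|] ->. Qed.

Definition fibre_elt n : W := (perm (@fibre_fun_inj n), 1%g).

Lemma fibre_eltE n b o :
  (fibre_elt n).1 (b, o) = (b, if b == Some (d0, (y, n)) then h o else o).
Proof. by rewrite permE. Qed.

Lemma fibre_eltP n : fibre_elt n \in setA :&: setC.
Proof.
have fA : fibre_elt n \in setA.
  apply/setAP; split; rewrite ?group1 ?perm1 //; exists 1%g => //.
  exists (fun b => if b == Some (d0, (y, n)) then h else 1%g) => b.
  rewrite block_actA1; split.
  - by rewrite rcoset1; case: ifP => _; rewrite ?group1.
  - case: (b =P Some (d0, (y, n))) => [->|_]; last by rewrite perm1 eqxx orbT.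
    by rewrite /= section_pt_x0 h_x0.
  - by move=> o; rewrite permE /fibre_fun /=; case: ifP => _; rewrite ?perm1.
rewrite inE fA setA_stab // (root_permE (s := 1%g)) ?perm1 ?eqxx //.
by move=> o; rewrite permE perm1.
Qed.

(* A subgroup normal in both groups fixes the copy [None] pointwise, and the two
   groups carry that copy along the chain to every copy [Some (d0, (y, n))]; this
   uses an orbit other than [d0], hence the intransitivity of [N]. *)
Lemma fibre_elt_core (K : {group W}) : K \subset setA :&: setC ->
  setA \subset 'N(K)%g -> setC \subset 'N(K)%g ->
  forall i j, (fibre_elt i * (fibre_elt j)^-1)%g \in K -> i = j.
Proof.
move=> /fintype.subsetP KB /fintype.subsetP AK /fintype.subsetP CK.
pose fixes (b : block) := forall k, k \in K -> forall o, k.1 (b, o) = (b, o).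
(* Each conjugate of [k] stays in [K], so its root permutation fixes [x0]. Hence [k] fixes every
   translate of [x0], that is, all of [O1]. *)
have fixes_root : fixes None.
  move=> k kK o; have := KB _ kK; rewrite inE => /andP[kA kC].
  have [_ ->] := setA_root kA; congr (_, _).
  have /imsetP[s sL eo] : o \in [set s x0 | s : {perm O1} in L1].
    have /atransP /(_ x0 (finset.in_setT _)) e := L1_trans.
    by have := finset.in_setT o; rewrite -e => /orbitP[s sL <-]; apply/imsetP; exists s.
  have [a [aA ae _]] := setA_lift sL.
  have kaK : (k ^ a^-1)%g \in K by rewrite memJ_norm // AK // groupV.
  have := KB _ kaK; rewrite inE => /andP[kaA]; rewrite setA_stab //.
  have [kaL _] := setA_root kaA.
  have : (root_perm (k ^ a^-1) * root_perm a = root_perm a * root_perm k)%g.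
    by rewrite -!root_permM // conjgE invgK -!mulgA mulVg mulg1.
  by move=> /permP/(_ x0) + /eqP e; rewrite !permM e ae -eo => <-.
have fixes_move g b b' (p : {perm O1}) : g \in 'N(K)%g ->
    (forall o, g.1 (b, o) = (b', p o)) -> fixes b -> fixes b'.
  move=> gK gb fb k kK o.
  have kgK : (k ^ g^-1)%g \in K by rewrite memJ_norm // groupV.
  have go : g.1 (b, p^-1%g o) = (b', o) by rewrite gb permKV.
  have := fb _ kgK (p^-1%g o); rewrite conjgE invgK => /(congr1 g.1).
  have -> u : g.1 ((g * (k * g^-1))%g.1 u) = k.1 (g.1 u).
    by rewrite (_ : (g * (k * g^-1))%g.1 = (g.1 * (k.1 * g.1^-1))%g) // !permM permKV.
  by rewrite go.
have stepA s d i : s \in L1 -> fixes (Some (d, i)) -> fixes (Some (oact s d, i)).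
  move=> sL; have [a [aA _ ae]] := setA_lift sL; have [p pe] := ae d i.
  by apply: (fixes_move a _ _ p) => //; exact: AK.
have stepC r b : r \in L2 -> fixes b -> fixes (block_actC 1 r b).
  move=> rL; have [c [cC _ ce]] := setC_lift rL.
  by apply: (fixes_move c _ _ 1%g) => [|o]; [exact: CK | rewrite perm1].
have [s sL sz] : exists2 s : {perm O1}, s \in L1 & s x0 = z.
  have /atransP /(_ x0 (finset.in_setT _)) e := L1_trans.
  by have := finset.in_setT z; rewrite -e => /orbitP[s sL <-]; exists s.
have zd : oact s d0 != d0.
  rewrite -val_eqE /= section_pt_x0 sz; have [n nN <-] := section_pt_ex z.
  apply: contra (z_orbit (groupVr nN)) => /eqP <-; by rewrite permK.
(* Move to the orbit of [z] by [s], apply the inverse of [r1] there, where the second group acts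
   without twist, and come back. *)
have level_up n : fixes (Some (d0, (r1 y, n))) -> fixes (Some (d0, (y, n))).
  move=> /(stepA s _ _ sL) /(stepC r1^-1%g); rewrite groupV => /(_ r1L) /=.
  rewrite (negPf zd) oact1 /level /= permK => /(stepA s^-1%g); rewrite groupV => /(_ sL).
  by rewrite -oactM ?groupV // mulgV oact1.
(* [shift] takes [j] to [(y, n)], [r1] takes that to [(r1 y, n)], and the inverse shift fixes the
   latter since [r1 y] differs from [y]. *)
have twist_step (j : option index) (n : 'I_m) : shift j = Some (y, n) ->
    twist r1 j = Some (r1 y, n).
  move=> jn; rewrite /twist !permM jn [level_perm _ _]permE /=.
  apply: (canLR (permK shift)).
  by rewrite permE /= (negPf r1y).
have fixesP k : forall n : 'I_m, val n = k -> fixes (Some (d0, (y, n))).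
  elim: k => [|k IHk] n nk; apply: level_up.
    have sn : shift None = Some (y, n) by rewrite permE /= -nk valK.
    by have := stepC _ _ r1L fixes_root; rewrite /= (twist_step _ _ sn).
  have km : k < m by rewrite -ltnS -nk ltnW // ltnS ltn_ord.
  have sn : shift (Some (y, Ordinal km)) = Some (y, n).
    by rewrite permE /= eqxx -nk valK.
  have := stepC _ _ r1L (IHk (Ordinal km) erefl).
  by rewrite /= ?eqxx (twist_step _ _ sn).
(* For distinct [i] and [j] the quotient acts as [h] on copy [i], yet fixes it pointwise. *)
move=> i j ijK; apply/eqP; apply: contraNT h_neq1 => ij.
apply/eqP/permP => o; rewrite perm1.
have := fixesP i i erefl _ ijK o.
rewrite (_ : (_ * _)%g.1 = ((fibre_elt i).1 * (fibre_elt j).1^-1)%g) // permM.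
rewrite fibre_eltE eqxx => /(canRL (permKV _)); rewrite fibre_eltE.
by case: eqP => [[ij']|_ [//]]; rewrite ij' eqxx in ij.
Qed.

End FiniteAmalgam.

(** * From a group that is not semiprimitive to the tree *)

Lemma ex_finite_amalgam (O1 O2 : finType)
    (L1 : {group {perm O1}}) (L2 : {group {perm O2}}) (m : nat) :
  L2 :!=: 1%g -> perm_transitive L1 -> ~ perm_semiprimitive L1 ->
  exists (W : finGroupType) (A C : {group W})
    (phi : W -> {perm O1}) (chi : W -> {perm O2}) (x : O1) (y : O2) (b : 'I_m -> W),
  [/\ {in A &, {morph phi : a b / (a * b)%g}} /\
        {in C &, {morph chi : a b / (a * b)%g}},
      (forall a, a \in A -> (a \in C) = (phi a x == x)) /\
        (forall a, a \in C -> (a \in A) = (chi a y == y)),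
      [set phi a | a in A]%SET = L1 /\ [set chi a | a in C]%SET = L2,
      (forall i, b i \in A :&: C) &
      (forall K : {group W}, K \subset A :&: C ->
        A \subset 'N(K)%g -> C \subset 'N(K)%g ->
        forall i j, (b i * (b j)^-1)%g \in K -> i = j)].
Proof.
move=> ntL2 trL1 nsp.
have [N [nN ntrN nsrN]] : exists N : {group {perm O1}},
    [/\ (N <| L1)%g, ~ perm_transitive N & ~ perm_semiregular N].
  apply: contrapT => noN; apply: nsp => N nN.
  by apply: contrapT => /not_orP[n1 n2]; apply: noN; exists N.
have [x0 [h [hN hx h1]]] : exists x0 (h : {perm O1}), [/\ h \in N, h x0 = x0 & h != 1%g].
  apply: contrapT => no; apply: nsrN => x s sN sx; apply/eqP; apply: contrapT => s1.
  by apply: no; exists x, s; split=> //; apply/negP.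
have [z zP] : exists z, forall n : {perm O1}, n \in N -> n x0 != z.
  apply: contrapT => no; apply: ntrN; apply/imsetP.
  exists x0; first exact: finset.in_setT.
  apply/esym/setP => z; rewrite [RHS]finset.in_setT; apply/orbitP.
  apply: contrapT => noz; apply: no; exists z => n nN'; apply/eqP => e.
  by apply: noz; exists n.
have [r [y [rL ry]]] : exists (r : {perm O2}) y, r \in L2 /\ r y != y.
  have [r rL r1] := trivgPn _ ntL2.
  apply: contrapT => no; move/eqP: r1; apply; apply/permP => y; rewrite perm1.
  by apply/eqP; apply: contrapT => ry; apply: no; exists r, y; split=> //; apply/negP.
exists _, (groupA L2 x0 y m nN), (groupC L2 x0 y m nN), (@root_perm _ _ N x0 m), snd.
exists x0, y, (@fibre_elt _ _ N x0 h y m); split.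
- by split=> [|a b _ _ //]; exact: root_permM.
- by split=> [a aA|a aC]; [exact: setA_stab | exact: setC_stab].
- by split; [exact: root_perm_image | exact: snd_image].
- exact: fibre_eltP.
- exact: (fibre_elt_core trL1 nN h1 zP rL ry).
Qed.

Lemma valency_labelling (T : sgraph) (v : T) (O : finType) (o0 : O) :
  has_valency v #|O| -> exists p : (T -> O) * (O -> T),
    [/\ forall o, adj v (p.2 o), forall o, p.1 (p.2 o) = o &
        forall w, adj v w -> p.2 (p.1 w) = w].
Proof.
move=> /card_set_bijP[f [fA finj fsurj]].
have /choice[nb nbP] : forall o : O, exists w, adj v w /\ f w = enum_rank o.
  by move=> o; have [w vw e] := fsurj (enum_rank o) (ltn_ord _); exists w.
(* The default [o0] is only reached at vertices that are not neighbours of [v]. *)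
pose lab w := if insub (f w) is Some k then enum_val (k : 'I_#|O|) else o0.
have labK o : lab (nb o) = o.
  by have [_ e] := nbP o; rewrite /lab e valK enum_rankK.
exists (lab, nb); split=> //= [o|w vw]; first by have [] := nbP o.
have [vn e] := nbP (lab w); apply: finj; rewrite ?inE //= e /lab.
by rewrite (insubT (fun k => k < #|O|) (fA w vw)) enum_valK.
Qed.

Lemma large_stabiliser (O1 O2 : finType)
    (L1 : {group {perm O1}}) (L2 : {group {perm O2}}) (T : sgraph) (m : nat) :
  L2 :!=: 1%g -> perm_transitive L1 -> perm_transitive L2 ->
  ~ perm_semiprimitive L1 -> is_biregular_tree T #|O1| #|O2| ->
  exists G : set (T -> T),
    [/\ is_automorphism_group G, is_locally G L1 L2
      & exists u v : T, adj u v /\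
          exists n : nat, stab2 G u v #= `I_n /\ m <= n].
Proof.
move=> ntL2 trL1 trL2 nsp [[inhT conT acT] [side [sadj val]]].
have [W [A1 [A2 [phi1 [phi2 [x1 [x2 [b]]]]]]]] := ex_finite_amalgam m ntL2 trL1 nsp.
case=> -[phiM1 phiM2] [st1 st2] [im1 im2] bB bK.
pose O t : finType := if t then O1 else O2.
pose A t : {group W} := if t then A1 else A2.
pose L t : {group {perm O t}} := match t with true => L1 | false => L2 end.
pose phi t : W -> {perm O t} := match t with true => phi1 | false => phi2 end.
pose x t : O t := match t with true => x1 | false => x2 end.
have phi_image t : [set phi t a | a in A t]%SET = L t by case: t.
have trL t : perm_transitive (L t) by case: t.
have phiM t : {in A t &, {morph phi t : a b / (a * b)%g}} by case: t.
have stA t a : a \in A t -> (a \in A (~~ t)) = (phi t a (x t) == x t).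
  by case: t; [exact: st1 | exact: st2].
have trA t (o : O t) : exists2 a, a \in A t & phi t a (x t) = o.
  have /atransP /(_ (x t) (finset.in_setT _)) e := trL t.
  have := finset.in_setT o; rewrite -e => /orbitP[s]; rewrite -phi_image.
  by case/imsetP=> a aA -> <-; exists a.
pose labelling t (v : T) (p : (T -> O t) * (O t -> T)) := side v = t ->
  [/\ forall o, adj v (p.2 o), forall o, p.1 (p.2 o) = o &
      forall w, adj v w -> p.2 (p.1 w) = w].
have labels t : exists F, forall v, @labelling t v (F v).
  have /choice[F FP] : forall v, exists p, @labelling t v p; last by exists F.
  move=> v; have [sv|sv] := eqVneq (side v) t; last first.
    by exists (fun=> x t, fun=> v) => e; rewrite e eqxx in sv.
  have vv : has_valency v #|O t| by have := val v; rewrite sv; case: (t).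
  by have [p pP] := valency_labelling (x t) vv; exists p.
pose F t := sval (cid (labels t)).
have FP t v : labelling t v (F t v) := svalP (cid (labels t)) v.
pose lab t v w := (F t v).1 w; pose nb t v o := (F t v).2 o.
have adj_nb t v (o : O t) : side v = t -> adj v (nb t v o).
  by move=> sv; have [+ _ _] := FP t v sv; exact.
have nbK t v (o : O t) : side v = t -> lab t v (nb t v o) = o.
  by move=> sv; have [_ + _] := FP t v sv; exact.
have labK t v w : side v = t -> adj v w -> nb t v (lab t v w) = w.
  by move=> sv; have [_ _ +] := FP t v sv; exact.
have local := carrier_local_action phiM stA trA sadj adj_nb nbK labK acT conT
  inhT phi_image.
have aut := carrier_group_aut phiM stA trA sadj adj_nb nbK labK acT conT inhT.
have ltrans := carrier_locally_transitive phiM stA trA sadj adj_nb nbK labK acT conT.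
have stab := carrier_stab2 phiM stA trA sadj adj_nb nbK labK acT conT inhT bB.
exists (carrier_group A phi x side lab nb); split; first exact: aut; last first.
  by apply: stab => K KB KN; apply: bK => //; [exact: (KN true) | exact: (KN false)].
split; first exact: ltrans.
(* If the given vertex is on side [false], any neighbour of it is on side [true]. *)
have [u su] : exists u, side u = true.
  have [u] := inhT; case su: (side u); first by exists u.
  have := sadj _ _ (adj_nb false u (x false) su); rewrite su.
  by case sv: (side _) => // _; exists (nb false u (x false)).
have uv := adj_nb true u (x true) su; have := sadj _ _ uv; rewrite su.
case sv: (side _) => // _; exists u, (nb true u (x true)); split=> //.
  exact: (local u true su).
exact: (local _ false sv).
Qed.

Lemma is_locally_sym (T : sgraph) (G : set (T -> T)) (O1 O2 : finType)
    (L1 : {group {perm O1}}) (L2 : {group {perm O2}}) :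
  is_locally G L1 L2 -> is_locally G L2 L1.
Proof.
by case=> tr [u [v [uv l1 l2]]]; split=> //; exists v, u; split; rewrite // adj_sym.
Qed.

Lemma is_biregular_tree_sym (T : sgraph) (d1 d2 : nat) :
  is_biregular_tree T d1 d2 -> is_biregular_tree T d2 d1.
Proof.
case=> treeT [side [sadj val]]; split=> //; exists (fun v => ~~ side v); split.
  by move=> u v /sadj; apply: contra => /eqP/negb_inj ->.
by move=> v; have := val v; case: (side v).
Qed.

Theorem theorem1p2 (O1 O2 : finType)
    (L1 : {group {perm O1}}) (L2 : {group {perm O2}})
    (L1_nontrivial : L1 :!=: 1%g) (L2_nontrivial : L2 :!=: 1%g)
    (L1_transitive : perm_transitive L1) (L2_transitive : perm_transitive L2)
    (T : sgraph) (T_tree : is_biregular_tree T #|O1| #|O2|)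
    (not_semiprimitive : ~ perm_semiprimitive L1 \/ ~ perm_semiprimitive L2) :
  forall c : int,
  exists G : set (T -> T),
    [/\ is_automorphism_group G,
        is_locally G L1 L2
      & exists u v : T, adj u v /\
          exists n : nat, stab2 G u v #= `I_n /\ (c <= n%:Z)%R].
Proof.
move=> c; have cn n : `|c|%N <= n -> (c <= n%:Z)%R.
  by case: c.
have [G [Gaut Gloc [u [v [uv [n [Gn /cn le_cn]]]]]]] : exists G : set (T -> T),
    [/\ is_automorphism_group G, is_locally G L1 L2
      & exists u v : T, adj u v /\
          exists n : nat, stab2 G u v #= `I_n /\ `|c|%N <= n].
  case: not_semiprimitive => nsp.
    exact: large_stabiliser.
  (* The case of [L2] follows by exchanging the two sides of the tree. *)
  have [G [Gaut Gloc Gstab]] := large_stabiliser `|c|%N L1_nontrivial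
    L2_transitive L1_transitive nsp (is_biregular_tree_sym T_tree).
  by exists G; split=> //; exact: is_locally_sym.
by exists G; split=> //; exists u, v; split=> //; exists n.
Qed.
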